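(* Let $n$ be a positive integer and $R$ a Dedekind domain such that (i) $\operatorname{char}R=0$, (ii) every prime divisor of $n$ is not invertible in $R$, and (iii) every prime divisor $p$ of $n$ is unramified in $R$. Let $R[X]$ be the polynomial ring in one variable over $R$ and $\Phi_n(X)$ the $n$-th cyclotomic polynomial. Then $R[X]/\langle \Phi_n(X)\rangle$ is a Dedekind domain, and $R[X]/\langle \Phi_n(X)\rangle\simeq R[\zeta_n]$, where $\zeta_n$ is a primitive $n$-th root of unity in an algebraic closure of the fraction field of $R$.
   Context: A prime $p$ is unramified in $R$ (with $\operatorname{char}R=0$) if $p$ is not invertible in $R$ and the ideal $pR$ is an intersection of maximal ideals of $R$. *)

(* Defs.v *)
From HB Require Import structures.
From mathcomp Require Import all_boot all_order all_algebra all_field.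
From mathcomp Require Import boolp classical_sets functions.

Set Implicit Arguments.
Unset Strict Implicit.
Unset Printing Implicit Defensive.

Import GRing.Theory.
Local Open Scope classical_set_scope.
Local Open Scope ring_scope.

Section Ideals.
Variable A : comNzRingType.
Implicit Types I M P : set A.

(* Unlike [idealr_closed], this allows the unit ideal, and it ranges over
   Prop-valued subsets. *)
Definition ideal I : Prop :=
  [/\ I 0, forall x y, I x -> I y -> I (x + y) & forall a x, I x -> I (a * x)].

Definition prime_ideal P : Prop :=
  [/\ ideal P, ~ P 1 & forall x y, P (x * y) -> P x \/ P y].

Definition maximal_ideal M : Prop :=
  [/\ ideal M, ~ M 1 & forall I, ideal I -> M `<=` I -> I = M \/ I = setT].

Definition ideal_span (s : seq A) : set A :=
  [set x | exists c : 'I_(size s) -> A, x = \sum_(i < size s) c i * s`_i].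

Definition noetherian : Prop :=
  forall I, ideal I -> exists s : seq A, I = ideal_span s.

Definition is_fraction_field (K : fieldType) (i : {rmorphism A -> K}) : Prop :=
  injective i /\ forall x : K, exists a b : A, b != 0 /\ x = i a / i b.

(* [{fraction A}] is only available when A carries an idomainType structure,
   which a quotient ring such as R[X]/(f) does not canonically have; hence the
   quantification over all (isomorphic) fields of fractions of A. *)
Definition integrally_closed : Prop :=
  forall (K : fieldType) (i : {rmorphism A -> K}), is_fraction_field i ->
  forall x : K, integralOver i x -> exists a : A, x = i a.

(* Fields count as Dedekind domains. *)
Definition dedekind_domain : Prop :=
  [/\ GRing.integral_domain_axiom A, noetherian, integrally_closed
    & forall P, prime_ideal P -> P <> [set 0] -> maximal_ideal P].

End Ideals.

Definition unramified (R : idomainType) (p : nat) : Prop :=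
  (p%:R : R) \isn't a GRing.unit /\
  exists2 F : set (set R), (forall M, F M -> maximal_ideal M)
    & ideal_span [:: p%:R] = \bigcap_(M in F) M.

Definition is_algebraic_closure (K : fieldType) (L : closedFieldType)
    (j : {rmorphism K -> L}) : Prop :=
  forall x : L, algebraicOver j x.

(* The subring f(A)[z] of L. *)
Definition ring_adjoin (A : comNzRingType) (L : fieldType) (f : A -> L) (z : L)
  : set L := range (fun p : {poly A} => (map_poly f p).[z]).

Definition Phi (R : comNzRingType) (n : nat) : {poly R} := map_poly intr 'Phi_n.

(* [{poly %/ h}] is R[X]/(mk_monic h), where mk_monic h is h if h is monic and
   nonconstant, and 'X otherwise; the next fact shows that [{poly %/ Phi R n}]
   is indeed R[X]/(Phi_n). *)
Lemma mk_monic_Phi (R : comNzRingType) (n : nat) :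
  (0 < n)%N -> mk_monic (Phi R n) = Phi R n.
Proof.
move=> n_gt0; have mP : Phi R n \is monic.
  by rewrite /Phi monic_map // Cyclotomic_monic.
rewrite /mk_monic mP andbT ifT // /Phi size_map_poly_id0.
  by rewrite size_Cyclotomic ltnS totient_gt0.
by rewrite (monicP (Cyclotomic_monic n)) rmorph1 oner_neq0.
Qed.

(* The quantification in [integrally_closed] is not vacuous. *)
Lemma is_fraction_field_tofrac (R : idomainType) :
  is_fraction_field (@FracField.tofrac R : {rmorphism R -> {fraction R}}).
Proof.
split=> [x y /eqP|x]; first by rewrite /= tofrac_eq => /eqP.
elim/quotW: x => x; exists (frac x).1, (frac x).2; split.
  exact: denom_ratioP.
have nz : FracField.tofrac (frac x).2 != 0.
  by rewrite tofrac_eq0 denom_ratioP.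
apply: (mulIf nz); rewrite /= divfK //; unlock FracField.tofrac.
rewrite -[LHS]FracField.pi_mul; apply/eqmodP => /=.
rewrite FracField.equivfE /FracField.mulf !numden_Ratio ?oner_neq0 ?mulr1 //.
  by rewrite mulrC.
all: by rewrite ?mulr1 denom_ratioP.
Qed.

(* Main.v *)
(** Let z be a primitive n-th root of unity in a field E containing R.
    For n = p^k * m with p prime to m, write z = w * xi with w, xi primitive
    roots of orders m and p^k, and put pi := 1 - xi, q := totient (p^k).  In
    R[z] the elements pi^q and p are associated, and so are Phi_m(z) and pi.

    Suppose Phi_m generates the relations of w over R.  Since pR is radical and
    w ^+ p is again a primitive m-th root, the Frobenius map shows that pR[w]
    is radical; as R[z] is integral over R, it follows that pi R[z] meets R[w]
    in pR[w].  Consequently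
    - a relation g(z) = 0 with deg g < totient n, expanded in powers of Phi_m,
      has all its coefficients divisible by p, hence by every power of p, hence
      g = 0: by induction on n, R[X]/(Phi_n) embeds into E;
    - pi R[z] is radical, so an integral element y with p * y in R[z] is in
      R[z].
    Finally, if y in Frac R[z] is integral then n * y is in R[z], by Fourier
    inversion: its coefficients are traces, which lie in R.  Dividing by the
    primes of n one at a time, R[z] is integrally closed. *)

From HB Require Import structures.
Require Import Defs.
From mathcomp Require Import all_boot all_order all_algebra all_field.
From mathcomp Require Import ring.
From mathcomp Require Import boolp classical_sets functions.

Set Implicit Arguments.
Unset Strict Implicit.
Unset Printing Implicit Defensive.

Import GRing.Theory.
Local Open Scope classical_set_scope.
Local Open Scope ring_scope.

(** * Cyclotomic polynomials and adjunction of roots of unity *)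

Section CyclotomicOverRing.
Variables (A : comNzRingType) (n : nat).

Lemma Phi_monic : Phi A n \is monic.
Proof. by rewrite /Phi monic_map // Cyclotomic_monic. Qed.

Lemma size_Phi : size (Phi A n) = (totient n).+1.
Proof.
rewrite /Phi size_map_poly_id0 ?size_Cyclotomic //.
by rewrite (monicP (Cyclotomic_monic n)) rmorph1 oner_neq0.
Qed.

Lemma map_Phi (B : comNzRingType) (f : {rmorphism A -> B}) :
  map_poly f (Phi A n) = Phi B n.
Proof.
by rewrite /Phi -map_poly_comp; apply: eq_map_poly => a; rewrite /= rmorph_int.
Qed.

Lemma prod_Phi :
  (0 < n)%N -> \prod_(d <- divisors n) Phi A d = 'X^n - 1.
Proof.
move=> n_gt0; rewrite /Phi.
have <- : map_poly intr ('X^n - 1 : {poly int}) = 'X^n - 1 :> {poly A}.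
  by rewrite rmorphB /= rmorph1 map_polyXn.
by rewrite -prod_Cyclotomic // rmorph_prod.
Qed.

End CyclotomicOverRing.

Section CyclotomicRoots.
Variable E : fieldType.

Lemma root_Xn_sub_1 (n : nat) (z : E) : (0 < n)%N ->
  root ('X^n - 1) z = has (fun d => root (Phi E d) z) (divisors n).
Proof.
move=> n_gt0; rewrite -prod_Phi // rootE horner_prod prodf_seq_eq0.
by apply: eq_has => d.
Qed.

(** A root of X^n - 1 is a root of some Phi_d with d dividing n; then z^d = 1, so the order n of z
    divides d. *)
Lemma prim_root_Phi (n : nat) (z : E) :
  n.-primitive_root z -> root (Phi E n) z.
Proof.
move=> zP; have n_gt0 := prim_order_gt0 zP.
have : root ('X^n - 1) z.
  by rewrite rootE !hornerE prim_expr_order ?subrr.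
rewrite root_Xn_sub_1 // => /hasP[d dn rd].
suff -> : n = d by [].
apply/eqP; rewrite eqn_dvd -dvdn_divisors // in dn *; rewrite dn andbT.
have d_gt0 : (0 < d)%N by apply: dvdn_gt0 dn.
rewrite (prim_order_dvd zP) -subr_eq0.
have : root ('X^d - 1) z.
  rewrite root_Xn_sub_1 //; apply/hasP; exists d => //.
  by rewrite -dvdn_divisors.
by rewrite rootE !hornerE.
Qed.

Definition prim_roots (n : nat) (z : E) : seq E :=
  [seq z ^+ (val k) | k : 'I_n in [pred i : 'I_n | coprime i n]].

Lemma mem_prim_roots n z u : n.-primitive_root z ->
  (u \in prim_roots n z) = n.-primitive_root u.
Proof.
move=> zP; rewrite -(root_cyclotomic zP) -root_prod_XsubC.
by rewrite /prim_roots big_image.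
Qed.

Lemma prim_roots_uniq n z : n.-primitive_root z -> uniq (prim_roots n z).
Proof.
move=> zP; apply/dinjectiveP => i j _ _ /eqP.
rewrite (eq_prim_root_expr zP) !modn_small ?ltn_ord //.
by move/eqP => ij; apply/val_inj.
Qed.

Lemma size_prim_roots n z : size (prim_roots n z) = totient n.
Proof.
apply: succn_inj; rewrite -(size_cyclotomic z n) /cyclotomic.
by rewrite -(big_image _ _ _ _ (fun y => 'X - y%:P)) size_prod_XsubC.
Qed.

Lemma Phi_cyclotomic (n : nat) (z : E) :
  n.-primitive_root z -> Phi E n = cyclotomic z n.
Proof.
move=> zP; rewrite [LHS](@all_roots_prod_XsubC _ _ (prim_roots n z)).
- by rewrite (monicP (Phi_monic _ _)) scale1r big_image.
- by rewrite size_Phi size_prim_roots.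
- apply/allP => y; rewrite (mem_prim_roots _ zP); exact: prim_root_Phi.
by rewrite uniq_rootsE prim_roots_uniq.
Qed.

(** X^n - 1 is separable, while a root of order d < n would be shared by its two factors Phi_d and
    Phi_n. *)
Lemma root_Phi_prim (n : nat) (z : E) :
  (0 < n)%N -> n%:R != 0 :> E -> root (Phi E n) z -> n.-primitive_root z.
Proof.
move=> n_gt0 nE rz.
have zn1 : z ^+ n = 1.
  apply/eqP; rewrite -subr_eq0.
  suff : root ('X^n - 1) z by rewrite rootE !hornerE.
  rewrite root_Xn_sub_1 //; apply/hasP; exists n => //.
  by rewrite -dvdn_divisors.
have [d zP dn] := prim_order_exists n_gt0 zn1.
have [<- //|dNn] := eqVneq d n.
have /= sep := separable_Xn_sub_1 nE.
have rd := prim_root_Phi zP.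
have nd : n \in divisors n by rewrite -dvdn_divisors.
have dd : d \in rem n (divisors n).
  by rewrite mem_rem_uniq ?divisors_uniq // inE dNn -dvdn_divisors.
move: sep; rewrite -prod_Phi // (big_rem n) //= (big_rem d) //= mulrA.
rewrite separable_mul => /and3P[+ _ _].
rewrite separable_mul => /and3P[_ _ /coprimep_root/(_ rz)].
by rewrite -rootE rd.
Qed.

End CyclotomicRoots.

(** * Divisibility in the subring R[z] of a field *)

Section Adjoin.
Variables (R : comNzRingType) (E : fieldType) (phi : {rmorphism R -> E}).

(** A boolean form of [ring_adjoin], to carry a subring structure. Divisibility of x by a in R[z] is
    expressed as membership of x / a. *)
Definition adj (z : E) : {pred E} := fun x => `[< ring_adjoin phi z x >].

Lemma adjP (z x : E) :
  reflect (exists g : {poly R}, x = (map_poly phi g).[z]) (x \in adj z).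
Proof.
apply: (iffP (asboolP _)) => [[g _ <-]|[g ->]]; first by exists g.
by exists g.
Qed.

Fact adj_subring_closed z : subring_closed (adj z).
Proof.
split=> [|_ _ /adjP[g ->] /adjP[h ->]|_ _ /adjP[g ->] /adjP[h ->]].
- by apply/adjP; exists 1; rewrite rmorph1 hornerC.
- by apply/adjP; exists (g - h); rewrite rmorphB hornerD hornerN.
- by apply/adjP; exists (g * h); rewrite rmorphM hornerM.
Qed.
HB.instance Definition _ z :=
  GRing.isSubringClosed.Build E (adj z) (adj_subring_closed z).

Lemma adj_horner z g : (map_poly phi g).[z] \in adj z.
Proof. by apply/adjP; exists g. Qed.

Lemma adj_C z a : phi a \in adj z.
Proof. by rewrite -[phi a](hornerC _ z) -map_polyC adj_horner. Qed.

Lemma adj_gen z : z \in adj z.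
Proof. by rewrite -[X in X \in _]hornerX -(map_polyX phi) adj_horner. Qed.

Lemma sub_adj z w : w \in adj z -> {subset adj w <= adj z}.
Proof.
move=> wz _ /adjP[g ->]; rewrite horner_coef rpred_sum // => i _.
by rewrite rpredM ?rpredX // coef_map adj_C.
Qed.

Lemma adj_integral z x :
  integralOver phi z -> x \in adj z -> integralOver phi x.
Proof.
move=> zI /adjP[g ->]; apply: integral_horner => //.
by apply/integral_poly => i; rewrite coef_map; exact: integral_id.
Qed.

Lemma unity_root_integral n z : (0 < n)%N -> z ^+ n = 1 -> integralOver phi z.
Proof.
move=> n_gt0 zn; exists ('X^n - 1); first exact: monicXnsubC.
by rewrite rmorphB /= rmorph1 map_polyXn rootE !hornerE zn subrr.
Qed.

(** The quotient is a geometric sum; for y = 1 it is 0 by the convention on division by 0. *)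
Lemma adj_one_subX z y i : y \in adj z -> (1 - y ^+ i) / (1 - y) \in adj z.
Proof.
move=> yz; have [->|y1] := eqVneq y 1.
  by rewrite expr1n subrr mul0r rpred0.
rewrite -[1 - _ ^+ _]opprB subrX1 -mulNr opprB mulrAC.
rewrite mulfV ?subr_eq0 1?eq_sym//.
by rewrite mul1r rpred_sum // => j _; rewrite rpredX.
Qed.

(** The powers y^i with i < d sum to 0, so d is the sum of the 1 - y^i, all multiples of 1 - y. *)
Lemma adj_nat_one_sub z y d :
  y \in adj z -> y != 1 -> y ^+ d = 1 -> d%:R / (1 - y) \in adj z.
Proof.
move=> yz y1 yd.
have s0 : \sum_(i < d) y ^+ i = 0.
  apply/eqP; have /eqP := subrX1 y d; rewrite yd subrr eq_sym mulf_eq0 subr_eq0.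
  by rewrite (negPf y1).
have -> : d%:R = \sum_(i < d) (1 - y ^+ i).
  by rewrite sumrB s0 subr0 sumr_const card_ord.
by rewrite mulr_suml rpred_sum // => i _; rewrite adj_one_subX.
Qed.

(* Clearing the denominators of a monic equation for y shows that a power of
   a * y is divisible by a. *)
Lemma adj_integral_pow z a y :
  a \in adj z -> a * y \in adj z -> integralOver phi y ->
  exists N, (0 < N)%N /\ (a * y) ^+ N / a \in adj z.
Proof.
move=> az ayz [P mP /rootP Py0].
have [->|a0] := eqVneq a 0.
  by exists 1%N; rewrite mul0r expr0n mul0r rpred0.
move: Py0; rewrite horner_coef size_map_poly_id0; last first.
  by rewrite (monicP mP) rmorph1 oner_neq0.
rewrite (polySpred (monic_neq0 mP)) big_ord_recr /=.
have -> : (map_poly phi P)`_(size P).-1 = 1.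
  by rewrite coef_map -lead_coefE (monicP mP) /= rmorph1.
rewrite mul1r; set d := (size P).-1 => e.
have d_gt0 : (0 < d)%N.
  rewrite lt0n; apply/eqP => d0; move: e; rewrite d0 big_ord0 add0r => /eqP.
  by rewrite oner_eq0.
exists d; split=> //.
(* Multiply the equation by a^d: each term of degree i < d keeps a spare factor a. *)
have -> : (a * y) ^+ d / a =
   - \sum_(i < d) phi P`_i * (a * y) ^+ i * a ^+ (d - i).-1.
  apply: (mulIf a0); rewrite divfK // mulNr mulr_suml.
  apply/eqP; rewrite -addr_eq0 addrC; apply/eqP.
  have := congr1 (fun t => a ^+ d * t) e.
  rewrite mulr0 mulrDr -exprMn; apply: etrans; congr (_ + _).
  rewrite mulr_sumr; apply: eq_bigr => i _; rewrite coef_map /=.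
  have -> : a ^+ d = a ^+ i * (a ^+ (d - i).-1 * a).
    by rewrite -exprSr prednK ?subn_gt0 // -exprD subnKC // ltnW.
  by rewrite exprMn; ring.
rewrite rpredN rpred_sum // => i _.
by rewrite !rpredM ?rpredX // adj_C.
Qed.

End Adjoin.

(** For p prime, this is injectivity of the Frobenius of R/pR, equivalently radicality of pR. *)
Definition radical_at (R : comNzRingType) (p : nat) : Prop :=
  forall a b : R, a ^+ p = p%:R * b -> exists c : R, a = p%:R * c.

(** * Independence of powers of roots of unity, and Frobenius modulo p *)

Section Independence.
Variables (R : idomainType) (E : fieldType) (phi : {rmorphism R -> E}).

(** For z of order n and d = totient n: the relations of z over R are the multiples of Phi_n. *)
Definition indep_powers (d : nat) (z : E) : Prop :=
  forall g : {poly R}, (size g <= d)%N -> (map_poly phi g).[z] = 0 -> g = 0.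

Lemma size_modPhi n (g : {poly R}) : (size (g %% Phi R n)%R <= totient n)%N.
Proof. by rewrite -ltnS -(size_Phi R) ltn_modp monic_neq0 // Phi_monic. Qed.

Lemma horner_modPhi n z (g : {poly R}) : n.-primitive_root z ->
  (map_poly phi (g %% Phi R n)).[z] = (map_poly phi g).[z].
Proof.
move=> zP; rewrite [in RHS](Pdiv.IdomainMonic.divp_eq (Phi_monic R n) g).
rewrite rmorphD rmorphM /= map_Phi hornerD hornerM.
by rewrite (rootP (prim_root_Phi zP)) mulr0 add0r.
Qed.

Lemma adj_small n z x : n.-primitive_root z -> x \in adj phi z ->
  exists g : {poly R}, (size g <= totient n)%N /\ x = (map_poly phi g).[z].
Proof.
move=> zP /adjP[g ->]; exists (g %% Phi R n).
by rewrite size_modPhi horner_modPhi.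
Qed.

Lemma indep_Phi_dvd n z (g : {poly R}) : n.-primitive_root z ->
  indep_powers (totient n) z -> (map_poly phi g).[z] = 0 ->
  exists h, g = h * Phi R n.
Proof.
move=> zP zI gz; exists (g %/ Phi R n).
rewrite [LHS](Pdiv.IdomainMonic.divp_eq (Phi_monic R n) g).
by rewrite [X in _ + X]zI ?addr0 ?size_modPhi ?horner_modPhi.
Qed.

(** Stands in for Galois conjugation: a relation of z is a multiple of Phi_n, which also vanishes at
    z'. *)
Lemma indep_conj n z z' (g : {poly R}) :
  n.-primitive_root z -> n.-primitive_root z' ->
  indep_powers (totient n) z -> (map_poly phi g).[z] = 0 ->
  (map_poly phi g).[z'] = 0.
Proof.
move=> zP z'P zI /(indep_Phi_dvd zP zI)[h ->].
by rewrite rmorphM /= map_Phi hornerM (rootP (prim_root_Phi z'P)) mulr0.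
Qed.

Section Frobenius.
Variables (p : nat) (z : E).
Hypotheses (p_pr : prime p) (p0 : p%:R != 0 :> E).

(** The middle binomial coefficients are multiples of p. *)
Lemma adj_exp_primeD a b : a \in adj phi z -> b \in adj phi z ->
  ((a + b) ^+ p - (a ^+ p + b ^+ p)) / p%:R \in adj phi z.
Proof.
move=> az bz; rewrite exprDn big_ord_recr /=.
rewrite -(big_mkord xpredT (fun i => a ^+ (p - i) * b ^+ i *+ 'C(p, i))).
rewrite big_ltn ?prime_gt0 // big_nat subn0 subnn !expr0 bin0 binn !mulr1n.
rewrite mulr1 mul1r; set S := \sum_(_ <= _ < _ | _) _.
have -> : a ^+ p + S + b ^+ p - (a ^+ p + b ^+ p) = S by ring.
rewrite mulr_suml.
rewrite rpred_sum // => i /(prime_dvd_bin p_pr)/dvdnP[k ->].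
by rewrite mulrnA -[_ *+ p]mulr_natr mulfK // rpredMn // rpredM ?rpredX.
Qed.

Lemma adj_exp_prime_sum k (F : 'I_k -> E) : (forall i, F i \in adj phi z) ->
  ((\sum_i F i) ^+ p - \sum_i F i ^+ p) / p%:R \in adj phi z.
Proof.
elim: k F => [|k IHk] F Fz.
  by rewrite !big_ord0 expr0n gtn_eqF ?prime_gt0 // subrr mul0r rpred0.
rewrite !big_ord_recr /=; set S := \sum_(i < k) _; set T := \sum_(i < k) _.
have Sz : S \in adj phi z by apply: rpred_sum.
have -> : (S + F ord_max) ^+ p - (T + F ord_max ^+ p) =
  ((S + F ord_max) ^+ p - (S ^+ p + F ord_max ^+ p)) + (S ^+ p - T) by ring.
by rewrite mulrDl rpredD ?adj_exp_primeD ?IHk.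
Qed.

End Frobenius.

Section RadicalModPrime.
Variables (m p : nat) (w : E).
Hypotheses (p_pr : prime p) (p0 : p%:R != 0 :> E) (pm : coprime p m).
Hypotheses (wP : m.-primitive_root w) (wI : indep_powers (totient m) (w ^+ p)).
Hypothesis radR : radical_at R p.

(** Write s as the sum of the g_i w^i, i < totient m. Modulo p, s^p is the sum of the g_i^p (w^p)^i;
    independence of the powers of w^p makes p divide each g_i^p, hence each g_i. *)
Lemma adj_prime_radical1 s :
  s \in adj phi w -> s ^+ p / p%:R \in adj phi w -> s / p%:R \in adj phi w.
Proof.
move=> sw spw.
have wpP : m.-primitive_root (w ^+ p) by rewrite prim_root_exp_coprime.
have sub : {subset adj phi w <= adj phi (w ^+ p)}.
  apply: sub_adj; have [k wE] := prim_rootP wpP (prim_expr_order wP).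
  by rewrite [X in X \in _]wE rpredX // adj_gen.
have [g [gs sE]] := adj_small wP sw.
have tz : (\sum_(i < totient m) phi (g`_i ^+ p) * (w ^+ p) ^+ i) / p%:R
    \in adj phi w.
  rewrite -[X in X / _](subKr (s ^+ p)) mulrBl rpredB //.
  rewrite sE (@horner_coef_wide _ (totient m)); last first.
    by rewrite (leq_trans (size_poly _ _)).
  under [X in _ - X]eq_bigr => i _.
    rewrite rmorphXn exprAC -exprMn -coef_map /=; over.
  apply: adj_exp_prime_sum => // i.
  by rewrite rpredM ?rpredX ?adj_gen // coef_map adj_C.
have [T [Ts TE]] := adj_small wpP (sub _ tz).
have /subr0_eq HT : \poly_(i < totient m) (g`_i ^+ p) - p%:R *: T = 0.
  apply: wI.
    rewrite (leq_trans (size_polyD _ _)) // geq_max size_poly size_polyN.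
    exact: leq_trans (size_scale_leq _ _) Ts.
  rewrite rmorphB /= map_polyZ hornerD hornerN hornerZ -TE rmorph_nat.
  rewrite mulrCA divff // mulr1 (@horner_coef_wide _ (totient m)); last first.
    by rewrite (leq_trans (size_poly _ _)) ?size_poly.
  apply/eqP; rewrite subr_eq0; apply/eqP; apply: eq_bigr => i _.
  by rewrite coef_map coef_poly ltn_ord.
have /choice[c cP] : forall i, exists c, g`_i = p%:R * c.
  move=> i; have [im|mi] := ltnP i (totient m); last first.
    by exists 0; rewrite mulr0 nth_default // (leq_trans gs).
  apply: (radR (b := T`_i)); rewrite -coefZ -HT coef_poly im //.
apply/adjP; exists (\poly_(i < totient m) c i).
rewrite sE; apply: (mulIf p0); rewrite divfK //.
rewrite -[p%:R](rmorph_nat phi) mulrC -hornerZ -map_polyZ; congr (_ .[w]).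
congr (map_poly _ _); apply/polyP => i; rewrite coefZ coef_poly cP.
case: ltnP => // mi; rewrite -cP nth_default ?mulr0 //; exact: leq_trans mi.
Qed.

(** Raise the exponent N to p^N, then strip one factor p of it at a time. *)
Lemma adj_prime_radical s N :
  s \in adj phi w -> s ^+ N / p%:R \in adj phi w -> s / p%:R \in adj phi w.
Proof.
move=> sw sN.
have {sN} : s ^+ (p ^ N) / p%:R \in adj phi w.
  have /subnK <- : (N <= p ^ N)%N by rewrite ltnW // ltn_expl // prime_gt1.
  by rewrite exprD -mulrA rpredM // rpredX.
elim: N s sw => [|N IHN] s sw; first by rewrite expr1.
rewrite expnS exprM => /(IHN _ (rpredX _ sw)).
exact: adj_prime_radical1.
Qed.

End RadicalModPrime.
End Independence.

Lemma card_coprime_ord n : #|[pred i : 'I_n | coprime i n]| = totient n.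
Proof.
rewrite totient_count_coprime -big_mkcond big_mkord -sum1_card.
by apply: eq_bigl => k; rewrite inE coprime_sym.
Qed.

(** Phi_(p^(k+1)) is the quotient of X^(p^(k+1)) - 1 by X^(p^k) - 1, a sum of p powers of X. *)
Lemma Phi_primeX1 (A : comNzRingType) p k :
  prime p -> (Phi A (p ^ k.+1)).[1] = p%:R.
Proof.
move=> p_pr; suff -> : Phi A (p ^ k.+1) = \sum_(i < p) 'X^(p ^ k) ^+ i.
  rewrite horner_sum; under eq_bigr => i _ do rewrite -exprM hornerXn expr1n.
  by rewrite sumr_const card_ord.
have pk0 j : (0 < p ^ j)%N by rewrite expn_gt0 prime_gt0.
have : perm_eq (divisors (p ^ k.+1)) ((p ^ k.+1)%N :: divisors (p ^ k)).
  apply: uniq_perm; rewrite ?divisors_uniq //= ?divisors_uniq ?andbT.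
    by rewrite -dvdn_divisors // dvdn_Pexp2l ?prime_gt1 // ltnn.
  move=> d; rewrite inE -!dvdn_divisors //; apply/idP/orP => [|[/eqP->//|]].
    case/(dvdn_pfactor _ _ p_pr) => j; rewrite leq_eqVlt => /predU1P[->|jk] ->.
      by left.
    by right; rewrite dvdn_exp2l.
  by move=> dk; apply: dvdn_trans dk _; rewrite dvdn_exp2l.
move=> dE; have := prod_Phi A (pk0 k.+1).
rewrite (perm_big _ dE) big_cons prod_Phi //= [in RHS]expnSr exprM.
(* A monic factor can be cancelled over any commutative ring. *)
rewrite [in RHS]subrX1 mulrC; exact: (monic_lreg (monicXnsubC (1 : A) (pk0 k))).
Qed.

Section PrimePowerRoot.
Variables (R : comNzRingType) (E : fieldType) (phi : {rmorphism R -> E}).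
Variables (p k : nat) (xi z : E).
Hypotheses (p_pr : prime p) (xiP : (p ^ k.+1).-primitive_root xi).
Hypothesis xiz : xi \in adj phi z.

Let prod_one_sub :
  p%:R = \prod_(i < p ^ k.+1 | coprime i (p ^ k.+1)) (1 - xi ^+ i).
Proof.
rewrite -(Phi_primeX1 E k p_pr) (Phi_cyclotomic xiP) horner_prod.
by apply: eq_bigr => i _; rewrite hornerXsubC.
Qed.

Let piX : (1 - xi) ^+ totient (p ^ k.+1) =
  \prod_(i < p ^ k.+1 | coprime i (p ^ k.+1)) (1 - xi).
Proof. by rewrite prodr_const card_coprime_ord. Qed.

(** Factor by factor: each 1 - xi^i is a multiple of 1 - xi. *)
Lemma adj_prime_div_piX :
  p%:R / (1 - xi) ^+ totient (p ^ k.+1) \in adj phi z.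
Proof.
rewrite prod_one_sub piX -prodf_div rpred_prod // => i _.
exact: adj_one_subX.
Qed.

(** Conversely, xi is a power of each primitive xi^i, so 1 - xi^i divides 1 - xi. *)
Lemma adj_piX_div_prime :
  (1 - xi) ^+ totient (p ^ k.+1) / p%:R \in adj phi z.
Proof.
rewrite prod_one_sub piX -prodf_div rpred_prod // => i ico.
have xiiP : (p ^ k.+1).-primitive_root (xi ^+ i).
  by rewrite prim_root_exp_coprime.
have [j {1}->] := prim_rootP xiiP (prim_expr_order xiP).
by apply: adj_one_subX; rewrite rpredX.
Qed.

End PrimePowerRoot.

Section CoprimeOrders.
Variables (R : comNzRingType) (E : fieldType) (phi : {rmorphism R -> E}).
Variables (a b : nat) (z y : E).
Hypotheses (ab : coprime a b) (a_gt0 : (0 < a)%N).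

Lemma coprime_expr1 (x : E) : x ^+ a = 1 -> x ^+ b = 1 -> x = 1.
Proof.
move=> xa xb; have [u v e _] := egcdnP b a_gt0.
have := congr1 (fun i => x ^+ i) e; rewrite (eqP ab) (mulnC u) (mulnC v).
by rewrite exprD !exprM xa xb !expr1n mul1r.
Qed.

(* 1 - y divides both a and b, hence is a unit. *)
Lemma adj_one_sub_unit : y \in adj phi z -> y ^+ (a * b) = 1 ->
  y ^+ a != 1 -> y ^+ b != 1 -> (1 - y)^-1 \in adj phi z.
Proof.
move=> yz yab ya yb.
have dv c d : y ^+ (c * d) = 1 -> y ^+ c != 1 -> d%:R / (1 - y) \in adj phi z.
  rewrite exprM => ycd yc.
  have -> : d%:R / (1 - y) = d%:R / (1 - y ^+ c) * ((1 - y ^+ c) / (1 - y)).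
    by rewrite mulrA divfK // subr_eq0 eq_sym.
  by rewrite rpredM ?adj_one_subX ?adj_nat_one_sub ?rpredX.
have [u v e _] := egcdnP b a_gt0; rewrite (eqP ab) in e.
have -> : (1 - y)^-1 = u%:R * (a%:R / (1 - y)) - v%:R * (b%:R / (1 - y)).
  by rewrite !mulrA -mulrBl -!natrM e natrD addrAC subrr add0r mul1r.
rewrite rpredB // rpredM ?rpred_nat //.
  by rewrite (dv b) // mulnC.
by rewrite (dv a).
Qed.

End CoprimeOrders.

(** Chinese remaindering gives i = 0 mod a, 1 mod b and j = 1 mod a, 0 mod b, so i + j = 1 mod
    ab. *)
Lemma prim_root_split (E : fieldType) (a b : nat) (z : E) :
  coprime a b -> (a * b).-primitive_root z ->
  exists i j, [/\ b.-primitive_root (z ^+ i), a.-primitive_root (z ^+ j)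
    & z = z ^+ i * z ^+ j].
Proof.
move=> ab zP; have := prim_order_gt0 zP; rewrite muln_gt0 => /andP[a0 b0].
exists (chinese a b 0 1), (chinese a b 1 0); split.
- have := exp_prim_root zP (chinese a b 0 1).
  have cb : coprime (chinese a b 0 1) b.
    by rewrite -coprime_modl chinese_modr // coprime_modl coprime1n.
  rewrite Gauss_gcdl // (gcdn_idPr _) ?mulKn //.
  by rewrite /dvdn chinese_modl // mod0n.
- have := exp_prim_root zP (chinese a b 1 0).
  have ca : coprime (chinese a b 1 0) a.
    by rewrite -coprime_modl chinese_modl // coprime_modl coprime1n.
  rewrite Gauss_gcdr // (gcdn_idPr _) ?mulnK //.
  by rewrite /dvdn chinese_modr // mod0n.
rewrite -exprD -[LHS]expr1; apply/eqP; rewrite (eq_prim_root_expr zP).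
rewrite chinese_remainder //; apply/andP; split; apply/eqP.
  by rewrite -modnDm !chinese_modl // mod0n add0n modn_mod.
by rewrite -modnDm !chinese_modr // mod0n addn0 modn_mod.
Qed.

(** * Adjoining roots of unity of prime power order *)

Section PrimeStep.
Variables (R : idomainType) (E : fieldType) (phi : {rmorphism R -> E}).
Variables (p k m : nat) (w xi : E).
Hypotheses (p_pr : prime p) (p0 : p%:R != 0 :> E) (pm : coprime p m).
Hypotheses (wP : m.-primitive_root w) (xiP : (p ^ k.+1).-primitive_root xi).
Hypotheses (wz : w \in adj phi (w * xi)) (xiz : xi \in adj phi (w * xi)).
Hypothesis wI :
  forall u, m.-primitive_root u -> indep_powers phi (totient m) u.
Hypothesis radR : radical_at R p.

Local Notation z := (w * xi).
Local Notation pi := (1 - xi).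
Local Notation q := (totient (p ^ k.+1)).

Let m_gt0 : (0 < m)%N := prim_order_gt0 wP.
Let pkm : coprime (p ^ k.+1) m.
Proof. by rewrite coprimeXl. Qed.
Let pk_gt0 : (0 < p ^ k.+1)%N.
Proof. by rewrite expn_gt0 prime_gt0. Qed.
Let pk_gt1 : (1 < p ^ k.+1)%N.
Proof. by rewrite -(expn0 p) ltn_exp2l // prime_gt1. Qed.

Lemma pi_neq0 : pi != 0.
Proof.
rewrite subr_eq0 eq_sym -(expr1 xi) -(prim_order_dvd xiP) dvdn1.
by rewrite gtn_eqF.
Qed.

Lemma pi_adj : pi \in adj phi z.
Proof. by rewrite rpredB ?rpred1. Qed.

Lemma adj_zw_integral x : x \in adj phi z -> integralOver phi x.
Proof.
apply: adj_integral; apply: (@unity_root_integral _ _ _ (m * p ^ k.+1)).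
  by rewrite muln_gt0 m_gt0.
rewrite exprMn exprM (prim_expr_order wP) mulnC exprM (prim_expr_order xiP).
by rewrite !expr1n mulr1.
Qed.

(* s ^+ q is p times an element integral over R, so p divides a power of s
   in R[w]. *)
Lemma adj_pi_contract s :
  s \in adj phi w -> s / pi \in adj phi z -> s / p%:R \in adj phi w.
Proof.
move=> sw spi.
have y_int : integralOver phi (s ^+ q / p%:R).
  apply: adj_zw_integral.
  have -> : s ^+ q / p%:R = (s / pi) ^+ q * (pi ^+ q / p%:R).
    by rewrite exprMn exprVn mulrA divfK // expf_neq0 ?pi_neq0.
  by rewrite rpredM ?rpredX // adj_piX_div_prime.
have [||N [_ +]] := adj_integral_pow (z := w) (a := p%:R) _ _ y_int.
- exact: rpred_nat.
- by rewrite mulrCA divff // mulr1 rpredX.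
rewrite [p%:R * _]mulrCA divff // mulr1 -exprM.
apply: (adj_prime_radical p_pr p0 pm wP) => //.
by apply: wI; rewrite prim_root_exp_coprime.
Qed.

(** As xi is 1 modulo pi, z and w agree modulo pi. *)
Lemma adj_horner_congr g :
  ((map_poly phi g).[z] - (map_poly phi g).[w]) / pi \in adj phi z.
Proof.
rewrite !horner_coef -sumrB mulr_suml rpred_sum // => i _.
rewrite exprMn -mulrBr.
have -> : w ^+ i * xi ^+ i - w ^+ i = - w ^+ i * (1 - xi ^+ i) by ring.
rewrite coef_map -!mulrA rpredM ?adj_C // rpredM ?rpredN ?rpredX //.
exact: adj_one_subX.
Qed.

(** Phi_m(z) is the product of the z - w^c with c prime to m. The factor z - w is -w pi; any other
    is -w^c (1 - y) with y = z / w^c, and 1 - y is a unit because neither y^m nor y^(p^(k+1)) is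
    1. *)
Lemma Phi_z_factor : exists u, [/\ (Phi E m).[z] = pi * u, u != 0,
  u \in adj phi z & u^-1 \in adj phi z].
Proof.
have w_neq0 : w != 0.
  apply/eqP => w_eq0; have /eqP := prim_expr_order wP.
  by rewrite w_eq0 expr0n gtn_eqF // eq_sym oner_eq0.
(* The exponent of w itself, reduced modulo [m] so that it is 0 when [m] is 1. *)
have c0P : (1 %% m < m)%N by rewrite ltn_mod.
pose c0 := Ordinal c0P.
have wc0 : w ^+ c0 = w by rewrite /= (prim_expr_mod wP).
have wV j : (w ^+ j)^-1 \in adj phi z.
  have [i ->] : exists i, (w ^+ j)^-1 = w ^+ i.
    have : (w ^+ j)^-1 ^+ m = 1.
      by rewrite exprVn exprAC (prim_expr_order wP) expr1n invr1.
    by case/(prim_rootP wP) => i ->; exists i.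
  by rewrite rpredX.
have w0 j : w ^+ j != 0.
  by rewrite expf_neq0 // w_neq0.
pose v (c : 'I_m) := z - w ^+ c.
have vP (c : 'I_m) : c != c0 ->
    [/\ v c != 0, v c \in adj phi z & (v c)^-1 \in adj phi z].
  move=> cc0; pose y := z / w ^+ c.
  have yz : y \in adj phi z by rewrite rpredM ?adj_gen.
  have vE : v c = - w ^+ c * (1 - y) by rewrite /v /y; field; exact: w0.
  have ym : y ^+ m = xi ^+ m.
    rewrite !exprMn exprVn exprAC (prim_expr_order wP) expr1n invr1.
    by rewrite mul1r mulr1.
  have ypk : y ^+ (p ^ k.+1) = (w / w ^+ c) ^+ (p ^ k.+1).
    by rewrite !exprMn (prim_expr_order xiP) mulr1.
  have ym1 : y ^+ m != 1.
    rewrite ym -(prim_order_dvd xiP); apply/negP => pkdm; move: pkm.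
    by rewrite /coprime (gcdn_idPl pkdm) gtn_eqF.
  have ypk1 : y ^+ (p ^ k.+1) != 1.
    rewrite ypk; apply: contra_neq cc0 => eq1.
    have : w / w ^+ c = 1.
      apply: (coprime_expr1 pkm) => //.
      by rewrite exprMn exprVn exprAC (prim_expr_order wP) expr1n divr1.
    move/(canRL (divfK (w0 c))); rewrite mul1r => wc.
    have /eqP : w ^+ c = w ^+ 1 by [].
    rewrite (eq_prim_root_expr wP) modn_small // => /eqP e.
    by apply/val_inj; rewrite /= -e.
  have y1 : 1 - y != 0.
    by rewrite subr_eq0; apply: contra_neq ym1 => <-; rewrite expr1n.
  rewrite vE; split.
  - by rewrite mulf_neq0 // oppr_eq0.
  - by rewrite rpredM ?rpredN ?rpredX // rpredB ?rpred1.
  rewrite invfM invrN rpredM ?rpredN //.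
  apply: (adj_one_sub_unit pkm) => //.
  by rewrite exprM ypk -exprM mulnC exprM exprMn exprVn exprAC
    (prim_expr_order wP) expr1n divr1 expr1n.
exists (- w * \prod_(c < m | coprime c m && (c != c0)) v c); split.
- rewrite (Phi_cyclotomic wP) horner_prod (bigD1 c0) /=; last first.
    by rewrite coprime_modl coprime1n.
  rewrite hornerXsubC wc0 mulrA; congr (_ * _); first by ring.
  by apply: eq_bigr => c _; rewrite hornerXsubC.
- rewrite mulf_neq0 ?oppr_eq0 ?w_neq0 //.
  by apply/prodf_neq0 => c /andP[_ /vP[]].
- by rewrite rpredM ?rpredN // rpred_prod // => c /andP[_ /vP[]].
rewrite invfM rpredM ?invrN ?rpredN //; first by have := wV 1%N; rewrite expr1.
by rewrite -prodfV rpred_prod // => c /andP[_ /vP[]].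
Qed.

(** Expand the quotient in powers of w and compare coefficients by independence. *)
Lemma adj_prime_coef (g : {poly R}) : (size g <= totient m)%N ->
  (map_poly phi g).[w] / p%:R \in adj phi w -> exists h, g = p%:R *: h.
Proof.
move=> sg /(adj_small wP)[h [sh e]]; exists h; apply/subr0_eq.
apply: (wI wP).
  rewrite (leq_trans (size_polyD _ _)) // geq_max sg size_polyN.
  exact: leq_trans (size_scale_leq _ _) sh.
rewrite rmorphB /= map_polyZ hornerD hornerN hornerZ -e rmorph_nat.
by rewrite mulrCA divff // mulr1 subrr.
Qed.

(* Induction on the length d of the Phi_m-adic expansion of g. *)
Lemma pi_adic_dvd d (g : {poly R}) :
  (d <= q)%N -> (size g <= d * totient m)%N ->
  (map_poly phi g).[z] / pi ^+ d \in adj phi z -> exists h, g = p%:R *: h.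
Proof.
elim: d g => [|d IHd] g dq.
  by rewrite mul0n leqn0 size_poly_eq0 => /eqP-> _; exists 0; rewrite scaler0.
move=> sg gz; have [u [uE u0 uz uVz]] := Phi_z_factor.
have pid0 j : pi ^+ j != 0 by rewrite expf_neq0 ?pi_neq0.
have Pm := Phi_monic R m.
set g0 := g %% Phi R m; set g1 := g %/ Phi R m.
have gE : g = g1 * Phi R m + g0 by rewrite -(Pdiv.IdomainMonic.divp_eq Pm).
have gzE : (map_poly phi g).[z] =
    (map_poly phi g1).[z] * pi * u + (map_poly phi g0).[z].
  by rewrite gE rmorphD rmorphM /= map_Phi hornerD hornerM uE mulrA.
(* pi divides g(z) and Phi_m(z), hence g0(z), hence g0(w); contraction to R[w] turns pi into p. *)
have [h0 h0E] : exists h, g0 = p%:R *: h.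
  apply: adj_prime_coef; first exact: size_modPhi.
  apply: adj_pi_contract; first exact: adj_horner.
  rewrite -(subKr (map_poly phi g0).[z] _.[w]) mulrBl.
  rewrite rpredB ?adj_horner_congr //.
  have -> : (map_poly phi g0).[z] / pi = (map_poly phi g).[z] / pi ^+ d.+1 *
      pi ^+ d - (map_poly phi g1).[z] * u.
    by rewrite gzE exprS; field; rewrite pi_neq0 pid0.
  by rewrite rpredB // rpredM ?rpredX ?pi_adj ?adj_horner.
(* As d + 1 <= q, pi^(d+1) divides p and so g0(z). It then divides the rest g1(z) pi u, where u is a
   unit. *)
have [h1 h1E] : exists h, g1 = p%:R *: h.
  apply: IHd; first exact: ltnW.
    rewrite /g1 size_divp ?monic_neq0 // size_Phi /= leq_subLR.
    by rewrite -mulSn.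
  have -> : (map_poly phi g1).[z] / pi ^+ d =
     ((map_poly phi g).[z] / pi ^+ d.+1 -
       (map_poly phi h0).[z] * (p%:R / pi ^+ q * pi ^+ (q - d.+1))) * u^-1.
    rewrite gzE h0E map_polyZ hornerZ rmorph_nat.
    have -> : pi ^+ q = pi ^+ (q - d.+1) * pi ^+ d.+1 by rewrite -exprD subnK.
    by rewrite exprS; field; rewrite u0 pi_neq0 !pid0.
  apply: rpredM => //; apply: rpredB => //; apply: rpredM.
    exact: adj_horner.
  by apply: rpredM; [exact: adj_prime_div_piX | rewrite rpredX ?pi_adj].
by exists (h1 * Phi R m + h0); rewrite gE h1E h0E scalerDr scalerAl.
Qed.

(** Modulo pi, s = g(z) equals t = g(w). So pi divides t^N, and p does in R[w] by contraction; then
    p divides t because pR[w] is radical, and pi divides p. *)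
Lemma adj_pi_radical s N : s \in adj phi z -> s ^+ N / pi \in adj phi z ->
  s / pi \in adj phi z.
Proof.
move=> sz sN; have [g sE] := adjP _ _ _ sz; pose t := (map_poly phi g).[w].
have tw : t \in adj phi w by exact: adj_horner.
have tz : t \in adj phi z by apply: sub_adj tw.
have st : (s - t) / pi \in adj phi z by rewrite sE adj_horner_congr.
suff tpi : t / pi \in adj phi z.
  by rewrite -(subrK t s) mulrDl rpredD.
have tp : t / p%:R \in adj phi w.
  apply: (@adj_prime_radical _ _ _ m p w _ _ _ _ _ _ _ N) => //.
    by apply: wI; rewrite prim_root_exp_coprime.
  apply: adj_pi_contract; first exact: rpredX.
  rewrite -(subKr (s ^+ N) (t ^+ N)) mulrBl rpredB // subrXX mulrAC rpredM //.
  by rewrite rpred_sum // => i _; rewrite rpredM ?rpredX.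
have q_gt0 : (0 < q)%N by rewrite totient_gt0.
have -> : t / pi = t / p%:R * (p%:R / pi ^+ q * pi ^+ q.-1).
  rewrite -(prednK q_gt0) exprS /=.
  by field; rewrite p0 pi_neq0 expf_neq0 // pi_neq0.
apply: rpredM; first exact: sub_adj tp.
by apply: rpredM; [exact: adj_prime_div_piX | rewrite rpredX ?pi_adj].
Qed.

(* Divide by pi one step at a time. *)
Lemma adj_prime_closed y : integralOver phi y ->
  p%:R * y \in adj phi z -> y \in adj phi z.
Proof.
move=> yI py.
(* pi divides a power of pi x because x is integral, hence pi x itself because pi R[z] is
   radical. *)
have step x : integralOver phi x -> pi * x \in adj phi z -> x \in adj phi z.
  move=> xI px; have [N [_ pN]] := adj_integral_pow pi_adj px xI.
  have := adj_pi_radical px pN.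
  by rewrite mulrAC mulfV ?mul1r ?pi_neq0.
have : pi ^+ q * y \in adj phi z.
  have -> : pi ^+ q * y = pi ^+ q / p%:R * (p%:R * y) by field.
  by rewrite rpredM // adj_piX_div_prime.
elim: q => [|j IHj]; first by rewrite mul1r.
rewrite exprS -mulrA => /step; rewrite -/(pi ^+ j) => h; apply: IHj; apply: h.
by apply: integral_mul => //; apply: adj_zw_integral; rewrite rpredX ?pi_adj.
Qed.

End PrimeStep.

(** * Independence and integral closure at every level *)

Lemma ideal_span_sub (A : comNzRingType) (I : set A) (s : seq A) :
  ideal I -> (forall i, (i < size s)%N -> I s`_i) -> ideal_span s `<=` I.
Proof.
move=> [I0 ID IM] sI _ [c ->]; apply: (big_ind I) => // i _.
by apply: IM; apply: sI.
Qed.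

Lemma ideal_span_ideal (A : comNzRingType) (s : seq A) : ideal (ideal_span s).
Proof.
split=> [|_ _ [c ->] [d ->]|a _ [c ->]].
- by exists (fun=> 0); rewrite big1 // => i _; rewrite mul0r.
- exists (fun i => c i + d i); rewrite -big_split.
  by apply: eq_bigr => i _; rewrite mulrDl.
- exists (fun i => a * c i); rewrite mulr_sumr.
  by apply: eq_bigr => i _; rewrite mulrA.
Qed.

Lemma ideal_span_mem (A : comNzRingType) (s : seq A) i :
  (i < size s)%N -> ideal_span s s`_i.
Proof.
move=> si; exists (fun j => (j == Ordinal si)%:R).
rewrite (bigD1 (Ordinal si)) //= eqxx mul1r big1 ?addr0 // => j /negPf->.
by rewrite mul0r.
Qed.

Lemma ideal_span1P (A : comNzRingType) (a x : A) :
  ideal_span [:: a] x <-> exists b, x = a * b.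
Proof.
split=> [[c ->]|[b ->]].
  by exists (c ord0); rewrite big_ord1 mulrC.
by exists (fun=> b); rewrite big_ord1 mulrC.
Qed.

(* The union over N of the colon ideals (a : x^N) is finitely generated, so
   it equals (a : x^N) for some N; write a = x^N.+1 * b there. *)
Lemma noetherian_inter_powers (R : idomainType) (x a : R) :
  noetherian R -> x \isn't a GRing.unit ->
  (forall N, exists b, a = x ^+ N * b) -> a = 0.
Proof.
move=> nR xNu aN.
have [x0|x0] := eqVneq x 0.
  by have [b ->] := aN 1%N; rewrite x0 expr1 mul0r.
pose I : set R := [set y | exists N c, x ^+ N * y = c * a].
have idI : ideal I.
  split=> [|y1 y2 [N1 [c1 e1]] [N2 [c2 e2]]|b y [N [c e]]].
  - by exists 0%N, 0; rewrite mulr0 mul0r.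
  - exists (N1 + N2)%N, (x ^+ N2 * c1 + x ^+ N1 * c2).
    by rewrite exprD mulrDl -!mulrA -e1 -e2; ring.
  - by exists N, (b * c); rewrite mulrCA e mulrA.
have [s sE] := nR I idI.
have gen t : (forall i, (i < size t)%N -> I t`_i) ->
    exists N, forall y, ideal_span t y -> exists c, x ^+ N * y = c * a.
  elim: t => [_|y t IHt st].
    by exists 0%N => _ [c ->]; exists 0; rewrite big_ord0 mulr0 mul0r.
  have [|N1 N1P] := IHt; first by move=> i si; apply: (st i.+1).
  have [N2 [d2 e2]] := st 0%N isT.
  exists (N1 + N2)%N => _ [c ->]; rewrite big_ord_recl /=.
  have [d1 e1] : exists d, x ^+ N1 * (\sum_(i < size t) c (lift ord0 i) * t`_i)
    = d * a by apply: N1P; exists (fun i => c (lift ord0 i)).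
  exists (x ^+ N1 * c ord0 * d2 + x ^+ N2 * d1).
  rewrite mulrDl -!mulrA -e2 -e1 exprD /=; ring.
have [|N NP] := gen s; first by move=> i si; rewrite sE; apply: ideal_span_mem.
have [b ab] := aN N.+1.
have [c cP] : exists c, x ^+ N * b = c * a.
  by apply: NP; rewrite -sE; exists N.+1, 1; rewrite mul1r.
have [->|a0] := eqVneq a 0; first by [].
(* Cancelling x^N b in x^N b = c a = c x^(N+1) b gives c x = 1. *)
exfalso; apply: (negP xNu); apply/unitrPr; exists c.
have b0 : b != 0 by apply: contra_neq a0 => b0; rewrite ab b0 mulr0.
apply: (mulIf (mulf_neq0 (expf_neq0 N x0) b0)).
by rewrite mul1r {2}cP ab exprS; ring.
Qed.

Lemma pfactor_split (p n : nat) : prime p -> (p %| n)%N -> (0 < n)%N ->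
  exists k m, [/\ n = (p ^ k.+1 * m)%N, coprime p m & (m < n)%N].
Proof.
move=> p_pr pn n_gt0; have [m pm nE] := pfactor_coprime p_pr n_gt0.
exists (logn p n).-1, m; have l_gt0 : (0 < logn p n)%N.
  by rewrite logn_gt0 mem_primes p_pr n_gt0.
rewrite prednK // mulnC -nE; split=> //.
have m_gt0 : (0 < m)%N by move: n_gt0; rewrite nE muln_gt0 => /andP[].
rewrite nE -[X in (X < _)%N]muln1 ltn_pmul2l //.
by rewrite -[1%N](expn0 p) ltn_exp2l // prime_gt1.
Qed.

(** * Clearing denominators in integral equations *)

Section Homogenization.
Variables (R : comNzRingType) (E : fieldType) (phi : {rmorphism R -> E}).

(** Turns an equation for x / phi r into a relation without division, which can be moved along
    injective morphisms. *)
Lemma homogenize_horner (P : {poly R}) (r : R) (x : E) : phi r != 0 ->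
  \sum_(i < size P) phi (P`_i * r ^+ ((size P).-1 - i)) * x ^+ i =
  phi r ^+ (size P).-1 * (map_poly phi P).[x / phi r].
Proof.
move=> r0; rewrite (@horner_coef_wide _ (size P)) ?size_poly // mulr_sumr.
apply: eq_bigr => i _; rewrite coef_map rmorphM rmorphXn exprMn exprVn /=.
have : (i <= (size P).-1)%N by have := ltn_ord i; case: (size P) i => [[]|].
move=> /subnK iP; rewrite -[in RHS]iP exprD.
by field; rewrite expf_neq0.
Qed.

End Homogenization.

(** E need not be a fraction field of R: the homogenised equation is pulled back to R, then read in
    [{fraction R}], where [integrally_closed] applies. *)
Lemma integrally_closed_fraction (R : idomainType) (E : fieldType)
    (phi : {rmorphism R -> E}) (c r : R) :
  integrally_closed R -> injective phi -> r != 0 ->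
  integralOver phi (phi c / phi r) -> exists b, phi c / phi r = phi b.
Proof.
move=> icR phi_inj r0 [P mP /rootP Pr].
have phir0 : phi r != 0 by rewrite raddf_eq0.
have fr0 : FracField.tofrac r != 0 by rewrite tofrac_eq0.
have H0 : \sum_(i < size P) P`_i * r ^+ ((size P).-1 - i) * c ^+ i = 0.
  apply: phi_inj; rewrite rmorph0 rmorph_sum /=.
  under eq_bigr => i _ do rewrite rmorphM rmorphXn.
  by rewrite homogenize_horner // Pr mulr0.
have [|b bE] := icR _ _ (is_fraction_field_tofrac R)
    (FracField.tofrac c / FracField.tofrac r).
- exists P => //; apply/rootP.
  apply: (mulfI (expf_neq0 (size P).-1 fr0)); rewrite mulr0.
  rewrite -(homogenize_horner _ _ fr0).
  have := congr1 (@FracField.tofrac R) H0; rewrite rmorph0; apply: etrans.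
  rewrite rmorph_sum /=; apply: eq_bigr => i _.
  by rewrite [in RHS]rmorphM (rmorphXn (@FracField.tofrac R)).
exists b; apply: (mulIf phir0); rewrite divfK // -rmorphM; congr (phi _).
have := congr1 (fun t => t * FracField.tofrac r) bE; rewrite divfK //= -rmorphM.
by move/eqP; rewrite tofrac_eq => /eqP.
Qed.

Lemma integral_sum (A B : comNzRingType) (f : {rmorphism A -> B})
    (I : Type) (r : seq I) (F : I -> B) :
  (forall i, integralOver f (F i)) -> integralOver f (\sum_(i <- r) F i).
Proof.
move=> Fint; apply: (big_ind (integralOver f)) => //.
- exact: integral0.
- exact: integral_add.
Qed.

Section CyclotomicIntegers.
Variables (R : idomainType) (E : fieldType) (phi : {rmorphism R -> E}).
Hypotheses (phi_inj : injective phi).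
Hypothesis charE : forall n, (0 < n)%N -> n%:R != 0 :> E.

Definition good_level (n : nat) : Prop :=
  forall p, prime p -> (p %| n)%N ->
    (p%:R : R) \isn't a GRing.unit /\ radical_at R p.

Lemma good_levelS m n : (m %| n)%N -> good_level n -> good_level m.
Proof. by move=> mn nG p p_pr pm; apply: nG => //; apply: dvdn_trans mn. Qed.

(** Strong induction on n, splitting off its least prime p. The coefficients of a relation are
    divisible by p and the quotient is again a relation, so they lie in every p^N R, and these meet
    in 0. *)
Lemma indep_prim_root (nR : noetherian R) n z :
  good_level n -> n.-primitive_root z -> indep_powers phi (totient n) z.
Proof.
elim/ltn_ind: n z => n IHn z nG zP; have n_gt0 := prim_order_gt0 zP.
have [n1|n1] := eqVneq n 1%N.
  move=> g; rewrite n1 => /size1_polyC-> /=; rewrite map_polyC hornerC => /eqP.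
  by rewrite raddf_eq0 // => /eqP->.
have p_pr : prime (pdiv n) by rewrite pdiv_prime // ltn_neqAle eq_sym n1.
set p := pdiv n in p_pr; have pn : (p %| n)%N by apply: pdiv_dvd.
have [pNu radR] := nG p p_pr pn.
have [k [m [nE pm mn]]] := pfactor_split p_pr pn n_gt0.
have pkm : coprime (p ^ k.+1) m by rewrite coprimeXl.
rewrite nE in zP; have [i [j [wP xiP zE]]] := prim_root_split pkm zP.
have zin l : z ^+ l \in adj phi (z ^+ i * z ^+ j).
  by rewrite rpredX // -zE adj_gen.
have wI u : m.-primitive_root u -> indep_powers phi (totient m) u.
  by apply: IHn => //; apply: good_levelS nG; rewrite nE dvdn_mull.
have step (g : {poly R}) : (size g <= totient n)%N ->
    (map_poly phi g).[z] = 0 -> exists h, g = p%:R *: h.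
  (* As totient n = q * totient m, the extreme case d = q is used; pi^q divides g(z) = 0. *)
  move=> sg gz; apply: (@pi_adic_dvd _ _ phi p k m (z ^+ i) (z ^+ j) p_pr _ pm
    wP xiP _ _ _ radR (totient (p ^ k.+1))) => //.
  - by apply: charE; rewrite prime_gt0.
  - by rewrite -totient_coprime // -nE.
  - by rewrite -zE gz mul0r rpred0.
have p0 : p%:R != 0 :> R.
  apply: contra_neq (charE (prime_gt0 p_pr)) => p0.
  by rewrite -(rmorph_nat phi) p0 rmorph0.
have iter N : forall g : {poly R}, (size g <= totient n)%N ->
    (map_poly phi g).[z] = 0 -> exists h, g = p%:R ^+ N *: h.
  elim: N => [|N IHN] g sg gz; first by exists g; rewrite expr0 scale1r.
  have [h hE] := step g sg gz; rewrite hE size_scale // in sg.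
  have [|h' h'E] := IHN h sg.
    move/eqP: gz; rewrite hE map_polyZ hornerZ mulf_eq0 raddf_eq0 //.
    by rewrite (negPf p0) => /eqP.
  by exists h'; rewrite hE h'E exprS scalerA.
move=> g sg gz; apply/polyP => l; rewrite coef0.
apply: (noetherian_inter_powers nR pNu) => N.
by have [h ->] := iter N g sg gz; exists h`_l; rewrite coefZ.
Qed.

(** The sum T of the G(X^i), i prime to n, takes the value t at every primitive root. Its remainder
    T' modulo Phi_n has degree below totient n, and T' - t has totient n roots, so T' is the
    constant t. *)
Lemma prim_trace n z (G : {poly R}) : n.-primitive_root z ->
  exists a, \sum_(u <- prim_roots n z) (map_poly phi G).[u] = phi a.
Proof.
move=> zP; set t := \sum_(u <- _) _.
pose T := \sum_(i < n | coprime i n) (G \Po 'X^i).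
pose T' := T %% Phi R n; exists T'`_0.
have T'E u : n.-primitive_root u -> (map_poly phi T').[u] = t.
  move=> uP; rewrite horner_modPhi // /T rmorph_sum horner_sum /=.
  (* The list of primitive roots depends on its generator only up to order. *)
  have zu : perm_eq (prim_roots n z) (prim_roots n u).
    apply: prod_XsubC_eq; rewrite !big_image.
    by have := Phi_cyclotomic zP; rewrite (Phi_cyclotomic uP).
  rewrite /t (perm_big _ zu) big_image /=; apply: eq_bigr => i _.
  by rewrite map_comp_poly map_polyXn horner_comp hornerXn.
suff /(congr1 (fun h : {poly E} => h`_0)) : map_poly phi T' = t%:P.
  by rewrite coef_map coefC.
apply/eqP; rewrite -subr_eq0; apply/negPn/negP => nz.
have n_gt0 := prim_order_gt0 zP.
have := @max_poly_roots _ _ (prim_roots n z) nz.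
rewrite prim_roots_uniq // size_prim_roots ltnNge => /(_ _ isT) /negP; apply.
  apply/allP => u; rewrite (mem_prim_roots _ zP) => uP.
  by rewrite rootE !hornerE T'E // subrr.
rewrite (leq_trans (size_polyD _ _)) // geq_max size_polyN.
rewrite (leq_trans (size_poly _ _)) ?size_modPhi //.
by rewrite (leq_trans (size_polyC_leq1 _)) // totient_gt0.
Qed.

(** * Integral closedness of R[z] *)

Section Closure.
Variables (n : nat) (z : E).
Hypotheses (nR : noetherian R) (icR : integrally_closed R).
Hypotheses (nG : good_level n) (zP : n.-primitive_root z).

Let n_gt0 : (0 < n)%N := prim_order_gt0 zP.

(** The equation of g(z) / r, homogenised, is a relation of z over R, so it holds at u by
    [indep_conj]. *)
Lemma integral_conj (g : {poly R}) r u : r != 0 -> n.-primitive_root u ->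
  integralOver phi ((map_poly phi g).[z] / phi r) ->
  integralOver phi ((map_poly phi g).[u] / phi r).
Proof.
move=> r0 uP [P mP /rootP Pz]; exists P => //; apply/rootP.
have phir0 : phi r != 0 by rewrite raddf_eq0.
pose H := \sum_(i < size P) (P`_i * r ^+ ((size P).-1 - i)) *: g ^+ i.
have HE v : (map_poly phi H).[v] =
    phi r ^+ (size P).-1 * (map_poly phi P).[(map_poly phi g).[v] / phi r].
  rewrite -homogenize_horner // /H rmorph_sum horner_sum /=.
  by apply: eq_bigr => i _; rewrite map_polyZ hornerZ rmorphXn horner_exp.
apply: (mulfI (expf_neq0 (size P).-1 phir0)); rewrite mulr0 -HE.
apply: (indep_conj zP uP (indep_prim_root nR nG zP)).
by rewrite HE Pz mulr0.
Qed.

(* Fourier inversion over the n-th roots of unity: the coefficient of z ^+ k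
   is the trace of y * z ^- k, which is integral and lies in Frac R. *)
Lemma integral_mul_order (g : {poly R}) r : r != 0 ->
  integralOver phi ((map_poly phi g).[z] / phi r) ->
  n%:R * ((map_poly phi g).[z] / phi r) \in adj phi z.
Proof.
move=> r0 yI; have phir0 : phi r != 0 by rewrite raddf_eq0.
pose y u := (map_poly phi g).[u] / phi r.
(* For k < n, [u ^+ (n - k)] is u^-k because u^n = 1. *)
pose T k := \sum_(u <- prim_roots n z) y u * u ^+ (n - k).
have TR k : exists b, T k = phi b.
  have [a aE] := prim_trace (g * 'X^(n - k)) zP.
  have TE : T k = phi a / phi r.
    rewrite -aE mulr_suml; apply: eq_bigr => u _.
    by rewrite rmorphM /= map_polyXn hornerM hornerXn mulrAC.
  rewrite TE; apply: integrally_closed_fraction => //; rewrite -TE /T.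
  rewrite big_seq_cond big_mkcond; apply: integral_sum => u.
  rewrite andbT (mem_prim_roots _ zP); case: ifP => uP; last exact: integral0.
  apply: integral_mul; first exact: integral_conj.
  apply: (@unity_root_integral _ _ _ n) => //.
  by rewrite exprAC (prim_expr_order uP) expr1n.
suff -> : n%:R * y z = \sum_(k < n) T k * z ^+ k.
  rewrite rpred_sum // => k _; have [b ->] := TR k.
  by rewrite rpredM ?adj_C ?rpredX ?adj_gen.
under eq_bigr => k _ do rewrite mulr_suml.
rewrite exchange_big /= (bigD1_seq z) ?prim_roots_uniq ?mem_prim_roots //=.
rewrite [X in _ + X]big_seq_cond [X in _ + X]big1 => [|u /andP[]].
  rewrite addr0 (eq_bigr (fun=> y z)) => [|k _].
    by rewrite sumr_const card_ord mulr_natl.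
  by rewrite -mulrA -exprD subnK 1?ltnW // (prim_expr_order zP) mulr1.
rewrite (mem_prim_roots _ zP) => uP uz.
have u0 : u != 0.
  apply/eqP => u_eq0; have /eqP := prim_expr_order uP.
  by rewrite u_eq0 expr0n gtn_eqF // eq_sym oner_eq0.
under eq_bigr => k _.
  have -> : y u * u ^+ (n - k) * z ^+ k = y u * (z / u) ^+ k.
    rewrite -mulrA; congr (_ * _); apply: (mulIf (expf_neq0 k u0)).
    rewrite mulrAC -exprD subnK 1?ltnW // (prim_expr_order uP) mul1r.
    by rewrite exprMn exprVn divfK // expf_neq0.
  over.
(* The geometric sum of ratio z / u vanishes: the ratio is not 1, but its n-th power is. *)
rewrite -mulr_sumr; apply/eqP; rewrite mulf_eq0; apply/orP; right.
have := subrX1 (z / u) n; rewrite exprMn exprVn !prim_expr_order // divr1 subrr.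
move/esym/eqP; rewrite mulf_eq0 subr_eq0 => /orP[/eqP e|//].
by rewrite -(divfK u0 z) e mul1r eqxx in uz.
Qed.

Lemma adj_prime_dvd_closed p y : prime p -> (p %| n)%N -> integralOver phi y ->
  p%:R * y \in adj phi z -> y \in adj phi z.
Proof.
move=> p_pr pn yI; have [pNu radR] := nG p_pr pn.
have [k [m [nE pm mn]]] := pfactor_split p_pr pn n_gt0.
have pkm : coprime (p ^ k.+1) m by rewrite coprimeXl.
have zP' := zP; rewrite nE in zP'.
have [i [j [wP xiP zE]]] := prim_root_split pkm zP'.
have zin l : z ^+ l \in adj phi (z ^+ i * z ^+ j).
  by rewrite rpredX // -zE adj_gen.
rewrite [in adj _ _]zE; apply: (@adj_prime_closed _ _ phi p k m) => //.
  by apply: charE; rewrite prime_gt0.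
move=> u uP; apply: indep_prim_root => //.
by apply: good_levelS nG; rewrite nE dvdn_mull.
Qed.

Lemma adj_integrally_closed (g : {poly R}) r : r != 0 ->
  integralOver phi ((map_poly phi g).[z] / phi r) ->
  (map_poly phi g).[z] / phi r \in adj phi z.
Proof.
move=> r0 yI; set y := _ / _ in yI *.
have : n%:R * y \in adj phi z by apply: integral_mul_order.
have : (n %| n)%N by [].
(* The multiplier n is generalised to a divisor N of n; its least prime is removed each time, while
   z keeps its order n. *)
elim/ltn_ind: {1 3}n (y) yI => N IHN x xI Nn.
have N_gt0 : (0 < N)%N by apply: dvdn_gt0 Nn.
have [->|N1] := eqVneq N 1%N; first by rewrite mul1r.
have p_pr : prime (pdiv N) by rewrite pdiv_prime // ltn_neqAle eq_sym N1.
have /dvdnP[M NE] := pdiv_dvd N.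
rewrite NE mulnC natrM -mulrA => px; apply: (IHN M) => //.
- rewrite NE ltn_Pmulr ?prime_gt1 //.
  by move: N_gt0; rewrite NE muln_gt0 => /andP[].
- by apply: dvdn_trans Nn; rewrite NE dvdn_mulr.
- apply: adj_prime_dvd_closed px => //; first exact: dvdn_trans (pdiv_dvd N) Nn.
  by apply: integral_mul => //; apply: integral_nat.
Qed.
End Closure.
End CyclotomicIntegers.

(** * Noetherianity and dimension of the quotient ring *)

Section MaximalIdeals.
Variable A : comNzRingType.

Lemma maximal_ideal_inv (M : set A) x : maximal_ideal M -> ~ M x ->
  exists c, M (1 - c * x).
Proof.
move=> [[M0 MD MM] M1 Mmax] xM.
(* The ideal M + Ax, which maximality makes the unit ideal. *)
pose I : set A := [set y | exists c, M (y - c * x)].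
have [||IM|IT] := Mmax I.
- split=> [|y1 y2 [c1 e1] [c2 e2]|a y [c e]].
  + by exists 0; rewrite mul0r subr0.
  + exists (c1 + c2); have := MD _ _ e1 e2; congr M; ring.
  + exists (a * c); have := MM a _ e; congr M; ring.
- by move=> y My; exists 0; rewrite mul0r subr0.
- by case: xM; rewrite -IM; exists 1; rewrite mul1r subrr.
- by have : I 1 by rewrite IT.
Qed.

(** If x is outside M, it is invertible modulo M and can be cancelled from x^k. *)
Lemma maximal_ideal_radical (M : set A) x k :
  maximal_ideal M -> M (x ^+ k) -> M x.
Proof.
move=> Mmax; have [[M0 MD MM] M1 _] := Mmax.
elim: k => [//|k IHk]; rewrite exprS => Mx.
have [//|xM] := pselect (M x); apply: IHk.
have [c e] := maximal_ideal_inv Mmax xM.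
have := MD _ _ (MM (x ^+ k) _ e) (MM c _ Mx); congr M; ring.
Qed.

End MaximalIdeals.

Lemma unramified_radical (R : idomainType) p :
  unramified R p -> radical_at R p.
Proof.
move=> [_ [F FM pE]] a b apb.
suff : ideal_span [:: p%:R] a by move/ideal_span1P.
rewrite pE => M FMM; apply: (maximal_ideal_radical (k := p) (FM _ FMM)).
have : ideal_span [:: p%:R] (a ^+ p) by apply/ideal_span1P; exists b.
by rewrite pE; apply.
Qed.

Lemma prime_ideal0 (A : comNzRingType) :
  GRing.integral_domain_axiom A -> prime_ideal [set 0 : A].
Proof.
move=> domA; split=> [|/eqP|x y /= /domA/orP[]/eqP].
2: by rewrite oner_eq0.
2: by left.
2: by right.
split=> //= [x y -> ->|a x ->]; [exact: addr0|exact: mulr0].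
Qed.

(** * Prime ideals in integral extensions *)

Section IntegralExtension.
Variables (A S : comNzRingType) (iota : {rmorphism A -> S}).
Hypothesis intS : integralRange iota.

(* In a monic equation for s modulo Q of least degree, the constant term is
   not in Q. *)
Lemma prime_ideal_multiple (Q : set S) s : prime_ideal Q -> ~ Q s ->
  exists t r, ~ Q (iota r) /\ Q (s * t + iota r).
Proof.
move=> [[Q0 QD QM] Q1 Qpr] sQ.
have [P mP /rootP Ps] := intS s.
have {Ps} : Q (map_poly iota P).[s] by rewrite Ps.
elim/poly_ind: P mP => [|P c IHP].
  by rewrite monicE lead_coef0 eq_sym oner_eq0.
rewrite rmorphD rmorphM /= map_polyX map_polyC !hornerE => mP Ps.
have [cQ|cQ] := pselect (Q (iota c)); last first.
  by exists (map_poly iota P).[s], c; rewrite mulrC.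
have PsQ : Q (s * (map_poly iota P).[s]).
  have := QD _ _ Ps (QM (-1) _ cQ); congr Q; ring.
have [//|] := Qpr _ _ PsQ; apply: IHP.
have [P0|P0] := eqVneq P 0.
  move: mP cQ; rewrite P0 mul0r add0r monicE lead_coefC => /eqP->.
  by rewrite rmorph1.
move: mP; rewrite !monicE lead_coefDl ?lead_coefMX //.
by rewrite size_mulX // ltnS (leq_trans (size_polyC_leq1 _)) // size_poly_gt0.
Qed.

(** The contraction p of P is prime, and nonzero because a nonzero element of P has a nonzero
    multiple in the image of A; so p is maximal. An ideal strictly above P contains some iota r with
    r outside p, and r is invertible modulo p. *)
Lemma prime_ideal_maximal_integral : GRing.integral_domain_axiom S ->
  (forall P : set A, prime_ideal P -> P <> [set 0] -> maximal_ideal P) ->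
  forall P : set S, prime_ideal P -> P <> [set 0] -> maximal_ideal P.
Proof.
move=> domS maxA P prP P0; have [[Pz PD PM] P1 Ppr] := prP.
pose p : set A := [set a | P (iota a)].
have pmax : maximal_ideal p.
  apply: maxA.
    split; first split; rewrite /p /=.
    - by rewrite rmorph0.
    - by move=> x y Px Py; rewrite rmorphD; apply: PD.
    - by move=> a x Px; rewrite rmorphM; apply: PM.
    - by rewrite rmorph1.
    - by move=> x y; rewrite rmorphM => /Ppr.
  move=> p0; apply: P0; apply/seteqP; split=> [s Ps|_ -> //] /=.
  apply: contrapT => s0.
  have [t [r [r0 e]]] := prime_ideal_multiple (prime_ideal0 domS) s0.
  have : p r.
    by rewrite /p /= -[iota r](addKr (s * t)) e addr0 -mulrN mulrC; apply: PM.
  by rewrite p0 /= => r_0; apply: r0; rewrite r_0 /= rmorph0.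
split=> // I [I0 ID IM] PI.
have [IP|/existsNP[s /not_implyP[Is sP]]] := pselect (I `<=` P).
  by left; apply/seteqP.
right; have [t [r [rP e]]] := prime_ideal_multiple prP sP.
have [c ce] := maximal_ideal_inv pmax (rP : ~ p r).
have I1 : I 1.
  have rI : I (iota r).
    rewrite -[iota r](addKr (s * t)); apply: ID; last exact: PI.
    by rewrite -mulrN mulrC; apply: IM.
  rewrite -(rmorph1 iota) -(subrK (c * r) 1) rmorphD.
  apply: ID; first exact: PI.
  by rewrite rmorphM; apply: IM.
by apply/seteqP; split=> // x _; rewrite -[x]mulr1; apply: IM.
Qed.

End IntegralExtension.

(** * Modules of polynomials of bounded degree *)

Section NoetherianModules.
Variable A : comNzRingType.

Definition submodule (N : set {poly A}) : Prop :=
  [/\ N 0, forall f g, N f -> N g -> N (f + g) & forall a f, N f -> N (a *: f)].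

(** As in Hilbert's basis theorem: lift generators of the ideal of top coefficients, then lower the
    degree. Generation by s is phrased through the submodules containing s, to avoid linear
    combinations. *)
Lemma submodule_fin_gen d (N : set {poly A}) : noetherian A -> submodule N ->
  (forall f, N f -> (size f <= d)%N) ->
  exists s : seq {poly A}, (forall f, f \in s -> N f) /\
    forall M, submodule M -> (forall f, f \in s -> M f) -> N `<=` M.
Proof.
move=> nA; elim: d N => [|d IHd] N [N0 ND NM] Nd.
  exists [::]; split=> // M [M0 _ _] _ f /Nd.
  by rewrite leqn0 size_poly_eq0 => /eqP->.
(* Taken relative to M so that a top coefficient is realised in both N and M; [J N] is the full
   coefficient ideal. *)
pose J (M : set {poly A}) : set A :=
  [set a | exists f, [/\ N f, M f & f`_d = a]].
have idJ M : submodule M -> ideal (J M).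
  move=> [M0 MD MM].
  split=> [|_ _ [f [Nf Mf <-]] [g [Ng Mg <-]]|a _ [f [Nf Mf <-]]].
  - by exists 0; rewrite coef0.
  - by exists (f + g); rewrite coefD; split; [apply: ND|apply: MD|].
  - by exists (a *: f); rewrite coefZ; split; [apply: NM|apply: MM|].
have [t tE] := nA (J N) (idJ N (And3 N0 ND NM)).
have /choice[l lP] : forall i : 'I_(size t), exists f, N f /\ f`_d = t`_i.
  move=> i; have : J N t`_i by rewrite tE; apply: ideal_span_mem.
  by case=> f [Nf _ fd]; exists f.
have [||s [sN sM]] := IHd [set f | N f /\ (size f <= d)%N].
- split=> /= [|f g [Nf sf] [Ng sg]|a f [Nf sf]].
  + by rewrite size_poly0.
  + split; first exact: ND.
    by rewrite (leq_trans (size_polyD _ _)) // geq_max sf.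
  + split; first exact: NM.
    exact: leq_trans (size_scale_leq _ _) sf.
- by move=> f [].
exists (codom l ++ s); split=> [f|M Msub genM f Nf].
  rewrite mem_cat => /orP[/codomP[i ->]|/sN[//]].
  by have [] := lP i.
have [M0 MD MM] := Msub.
have [g [Ng Mg gd]] : J M f`_d.
  have : J N f`_d by exists f.
  rewrite tE; apply: (ideal_span_sub (idJ M Msub)) => i ti.
  have [Nl ld] := lP (Ordinal ti); exists (l (Ordinal ti)); split=> //.
  by apply: genM; rewrite mem_cat codom_f.
rewrite -(subrK g f); apply: MD => //; apply: sM => //.
  by move=> h hs; apply: genM; rewrite mem_cat hs orbT.
have Nfg : N (f - g) by rewrite -scaleN1r; apply: ND => //; apply: NM.
split=> //=; apply/leq_sizeP => i; rewrite leq_eqVlt => /predU1P[<-|di].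
  by rewrite coefB gd subrr.
by move/leq_sizeP: (Nd _ Nfg); apply.
Qed.

End NoetherianModules.

(** * The quotient of R[X] by a polynomial *)

Section QuotientRing.
Variables (R : idomainType) (h : {poly R}).
Local Notation S := {poly %/ h}.

Lemma in_qpoly_val (s : S) : in_qpoly h s = s.
Proof.
by apply/val_inj; rewrite /= Pdiv.CommonRing.rmodp_small // size_mk_monic.
Qed.

Lemma horner_qpolyX (g : {poly R}) :
  (map_poly (qpolyC h) g).['qX] = in_qpoly h g.
Proof.
elim/poly_ind: g => [|g c IHg]; first by rewrite map_poly0 horner0 raddf0.
rewrite rmorphD rmorphM /= map_polyX map_polyC !hornerE IHg.
rewrite (rmorphD (in_qpoly h)) (rmorphM (in_qpoly h)); congr (_ + _).
by rewrite -[LHS]in_qpoly_val.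
Qed.

Lemma in_qpoly_mk_monic : in_qpoly h (mk_monic h) = 0.
Proof.
by apply/val_inj; rewrite /= Pdiv.RingMonic.rmodpp // monic_mk_monic.
Qed.

Lemma qpoly_integral : integralRange (qpolyC h).
Proof.
move=> s; rewrite -[s]in_qpoly_val -horner_qpolyX; apply: integral_horner.
  by apply/integral_poly => i; rewrite coef_map; apply: integral_id.
exists (mk_monic h); first exact: monic_mk_monic.
by rewrite rootE horner_qpolyX in_qpoly_mk_monic.
Qed.

(** The reduced representatives of an ideal form an R-submodule of bounded degree, whose generators
    also generate the ideal. *)
Lemma qpoly_noetherian : noetherian R -> noetherian S.
Proof.
move=> nR I idI; have [I0 ID IM] := idI.
pose N (J : set S) : set {poly R} :=
  [set f | exists2 s : S, J s & f = s :> {poly R}].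
have Nsub J : ideal J -> submodule (N J).
  move=> [J0 JD JM]; split=> [|_ _ [s Js ->] [t Jt ->]|a _ [s Js ->]].
  - by exists 0.
  - by exists (s + t) => //; apply: JD.
  - by exists (a *: s) => //; rewrite -[s]mul1r scalerAl; apply: JM.
have [|s [sI sM]] := @submodule_fin_gen _ (size (mk_monic h)) _ nR (Nsub I idI).
  by move=> _ [t _ ->]; rewrite ltnW // size_mk_monic.
have gen f : f \in s -> N (ideal_span (map (in_qpoly h) s)) f.
  move=> fs; exists (in_qpoly h f).
    have <- : (map (in_qpoly h) s)`_(index f s) = in_qpoly h f.
      by rewrite (nth_map 0) ?index_mem // nth_index.
    by apply: ideal_span_mem; rewrite size_map index_mem.
  by have [u _ ->] := sI f fs; rewrite in_qpoly_val.
exists (map (in_qpoly h) s); apply/seteqP; split=> [t It|].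
  have tN : N I t by exists t.
  have [t' t'I /val_inj->//] := sM _ (Nsub _ (ideal_span_ideal _)) gen _ tN.
apply: ideal_span_sub => // i; rewrite size_map => si.
rewrite (nth_map 0) //; have [u Iu ->] := sI _ (mem_nth 0 si).
by rewrite in_qpoly_val.
Qed.

(** Evaluate the reduced representative: since the modulus vanishes at z, any representative gives
    the same value, whence multiplicativity. *)
Lemma qpoly_eval (E : fieldType) (phi : {rmorphism R -> E}) (z : E) :
  root (map_poly phi (mk_monic h)) z ->
  exists F : {rmorphism S -> E},
    forall g, F (in_qpoly h g) = (map_poly phi g).[z].
Proof.
move=> /rootP rz; pose f (s : S) := (map_poly phi (s : {poly R})).[z].
have fE g : f (in_qpoly h g) = (map_poly phi g).[z].
  rewrite /f /= [in RHS](Pdiv.RingMonic.rdivp_eq (monic_mk_monic h) g).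
  by rewrite rmorphD rmorphM hornerD hornerM rz mulr0 add0r.
have fadd : zmod_morphism f.
  by move=> s t; rewrite /f [polyn _]raddfB rmorphB hornerD hornerN.
have fmul : monoid_morphism f.
  split; first by rewrite /f /= rmorph1 hornerC.
  move=> s t; rewrite -[s]in_qpoly_val -[t]in_qpoly_val -rmorphM !fE.
  by rewrite rmorphM hornerM.
pose fa := GRing.isZmodMorphism.Build _ _ f fadd.
pose fm := GRing.isMonoidMorphism.Build _ _ f fmul.
by exists (HB.pack f fa fm : {rmorphism S -> E}).
Qed.

End QuotientRing.

Lemma irreducible_factor_exists (K : fieldType) (f : {poly K}) :
  (1 < size f)%N -> exists2 g, irreducible_poly g & g %| f.
Proof.
move: {2}(size f) (leqnn (size f)) => d.
elim: d f => [|d IHd] f sfd sf; first by move: (leq_trans sf sfd).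
have [irr|/not_andP[//|]] := pselect (irreducible_poly f); first by exists f.
move=> /existsNP[g /not_implyP[/eqP sg /not_implyP[gf /negP gNf]]].
have f0 : f != 0 by rewrite -size_poly_gt0 ltnW.
have g0 : g != 0 by apply: contraTneq gf => ->; rewrite dvd0p.
have sg1 : (1 < size g)%N.
  by rewrite ltn_neqAle size_poly_gt0 g0 andbT eq_sym; apply/eqP.
have [|//|k irr kg] := IHd g; last by exists k => //; apply: dvdp_trans kg gf.
rewrite -ltnS (leq_trans _ sfd) // ltn_neqAle dvdp_leq // andbT.
by rewrite dvdp_size_eqp.
Qed.

(** Adjoin a root of an irreducible factor of Phi_n; it is primitive because n is nonzero. *)
Lemma prim_root_extension (K : fieldType) n : (0 < n)%N -> n%:R != 0 :> K ->
  exists (E : fieldType) (j : {rmorphism K -> E}) (z : E), n.-primitive_root z.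
Proof.
move=> n_gt0 nK; have [|g /irredp_FAdjoin[E _ [z gz _]] gPhi] :=
  @irreducible_factor_exists K (Phi K n).
  by rewrite size_Phi ltnS totient_gt0.
exists E, (in_alg E), z; apply: root_Phi_prim => //.
  by rewrite -(rmorph_nat (in_alg E)) fmorph_eq0.
rewrite -(map_Phi n (in_alg E)); have /dvdpP[q ->] := gPhi.
by rewrite rmorphM rootM gz orbT.
Qed.

Theorem theorem3p3 (n : nat) (R : idomainType)
    (n_gt0 : (0 < n)%N)
    (dedR : dedekind_domain R)
    (charR : [pchar R] =i pred0)
    (ninvR : forall p : nat, prime p -> (p %| n)%N ->
       (p%:R : R) \isn't a GRing.unit)
    (unramR : forall p : nat, prime p -> (p %| n)%N -> unramified R p) :
  dedekind_domain {poly %/ Phi R n} /\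
  (forall (L : closedFieldType) (j : {rmorphism {fraction R} -> L}) (z : L),
     is_algebraic_closure j -> n.-primitive_root z ->
     exists f : {rmorphism {poly %/ Phi R n} -> L},
       (forall a : R, f (qpolyC (Phi R n) a) = j (FracField.tofrac a)) /\
       set_bij [set: {poly %/ Phi R n}]
         (ring_adjoin (fun a : R => j (FracField.tofrac a)) z) f).
Proof.
have [domR nR icR maxR] := dedR; set h := Phi R n.
have monE : mk_monic h = h by apply: mk_monic_Phi.
have nG : good_level R n.
  by move=> p p_pr pn; split; [apply: ninvR | apply/unramified_radical/unramR].
have charR0 N : (0 < N)%N -> N%:R != 0 :> R.
  by move=> N_gt0; rewrite (pcharf0P R).1 // -lt0n.
have charE (E : fieldType) (phi : {rmorphism R -> E}) : injective phi ->
    forall N, (0 < N)%N -> N%:R != 0 :> E.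
  by move=> phi_inj N N_gt0; rewrite -(rmorph_nat phi) raddf_eq0 // charR0.
have tofrac_inj : injective (@FracField.tofrac R).
  by have [] := is_fraction_field_tofrac R.
(* Evaluation at a primitive root is injective: a reduced representative in its kernel is a relation
   of size at most totient n. *)
have evalP (E : fieldType) (phi : {rmorphism R -> E}) (z : E) :
    injective phi -> n.-primitive_root z ->
    exists2 F : {rmorphism {poly %/ h} -> E}, injective F &
      forall g, F (in_qpoly h g) = (map_poly phi g).[z].
  move=> phi_inj zP; have [|F FE] := @qpoly_eval _ h _ phi z.
    by rewrite monE map_Phi prim_root_Phi.
  have F0 s : F s = 0 -> s = 0.
    move=> Fs; apply/val_inj; apply: (indep_prim_root phi_inj _ nR nG zP) => /=.
    - exact: charE phi_inj.
    - by rewrite -ltnS -(size_Phi R) -/h -[in X in (_ < X)%N]monE size_mk_monic.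
    - by rewrite -FE in_qpoly_val.
  by exists F => //; apply: raddf_inj.
(* The quotient embeds into an extension field of Frac R that has a primitive n-th root. *)
have domS : GRing.integral_domain_axiom {poly %/ h}.
  have [|E [j [z zP]]] := @prim_root_extension {fraction R} n n_gt0.
    exact: charE tofrac_inj _ n_gt0.
  have [|F F_inj _] := evalP E (j \o @FracField.tofrac R) z _ zP.
    by apply: inj_comp tofrac_inj; apply: fmorph_inj.
  move=> s t st0; rewrite -!(raddf_eq0 _ F_inj) -mulf_eq0 -rmorphM st0.
  by rewrite rmorph0.
split; first split=> //.
- exact: qpoly_noetherian.
- move=> K i [i_inj fracK] x [P mP Px].
  pose phi : {rmorphism R -> K} := i \o qpolyC h.
  (* The image of X is a root of Phi_n, hence a primitive n-th root as n is nonzero in K. *)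
  pose z := i 'qX.
  have phi_inj : injective phi.
    apply: inj_comp i_inj _ => a b /(congr1 val)/=; exact: polyC_inj.
  have phiE g : (map_poly phi g).[z] = i (in_qpoly h g).
    by rewrite map_poly_comp horner_map horner_qpolyX.
  have zP : n.-primitive_root z.
    apply: root_Phi_prim => //; first exact: charE phi_inj _ n_gt0.
    rewrite -(map_Phi n phi) rootE phiE -/h -[X in in_qpoly h X]monE.
    by rewrite in_qpoly_mk_monic rmorph0.
  have xI : integralOver phi x.
    apply: integral_root_monic Px _; first exact: monic_map.
    apply/integral_poly => l; rewrite coef_map.
    by apply: integral_rmorph; apply: qpoly_integral.
  have [a [b [b0 xE]]] := fracK x.
  (* Trade the denominator b for one in R: b t = -r gives x = a / b = -(a t) / r. *)
  have [|t [r [r0 btr]]] := prime_ideal_multiple (@qpoly_integral _ h)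
     (prime_ideal0 domS) (s := b); first exact/eqP.
  have {}r0 : r != 0 by apply/eqP => r_0; apply: r0; rewrite r_0 /= rmorph0.
  have xE' : x = (map_poly phi (- (a * t) : {poly %/ h})).[z] / phi r.
    have ib0 : i b != 0 by rewrite raddf_eq0.
    have phir0 : phi r != 0 by rewrite raddf_eq0.
    have btr' : i b * i t = - phi r.
      apply/eqP; rewrite -addr_eq0; apply/eqP.
      by have := congr1 i btr; rewrite rmorph0 rmorphD rmorphM.
    rewrite phiE (_ : in_qpoly h _ = - (a * t)); last exact: in_qpoly_val.
    apply: (mulIf phir0); rewrite divfK // rmorphN rmorphM xE.
    by rewrite -[phi r]opprK -btr' mulrN mulrA divfK.
  have : x \in adj phi z.
    rewrite xE'.
    apply: (adj_integrally_closed phi_inj (charE _ _ phi_inj) nR icR nG zP r0).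
    by rewrite -xE'.
  by case/adjP=> g ->; exists (in_qpoly h g); rewrite phiE.
- exact: prime_ideal_maximal_integral (@qpoly_integral _ h) domS maxR.
move=> L j z _ zP; pose phi : {rmorphism R -> L} := j \o @FracField.tofrac R.
have phi_inj : injective phi by apply: inj_comp tofrac_inj; apply: fmorph_inj.
have [F F_inj FE] := evalP L phi z phi_inj zP.
exists F; split=> [a|].
  by rewrite -[qpolyC h a]in_qpoly_val FE map_polyC hornerC.
split=> [s _|s t _ _ /F_inj //|_ [g _ <-]].
  by exists (s : {poly R}) => //; rewrite -FE in_qpoly_val.
by exists (in_qpoly h g); rewrite ?FE.
Qed.
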